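(* The map $\zeta^T:\mathrm{Tree}(\mathbb{N}^* )^{\mathrm{conv}}\to\mathbb{R}$ is an algebra morphism for the quasi-shuffle product $*$ of $\mathrm{Tree}(\mathbb{N}^* )$: for any pair of trees $(t_1,t_2)\in(\mathrm{Tree}(\mathbb{N}^* )^{\mathrm{conv}})^2$, $$\zeta^T(t_1*t_2)=\zeta^T(t_1)\,\zeta^T(t_2).$$
   Context: Vector spaces are over $\mathbb{R}$; $\mathbb{N}^*=\{1,2,\dots\}$. **Trees.** A Schroeder tree is a planar rooted tree each of whose internal (non-leaf) vertices has at least two children; $|$ is the tree with no internal vertex. An angle of an internal vertex $v$ is a pair of consecutive (left to right) edges from $v$ to its children. $\nu(t)$ is the set of internal vertices of $t$. $\mathrm{Tree}(\mathbb{N}^* )$ is the vector space with basis the Schroeder trees whose internal vertices $v$ are decorated by elements $n_v\in\mathbb{N}^*$ that are at least the number of angles of $v$. $\mathrm{Tree}(\mathbb{N}^* )^{\mathrm{conv}}$ is the subspace spanned by $|$ and the trees whose root is not decorated by $1$. **Arborified zeta values.** $\zeta^T$ is the linear map given on trees of $\mathrm{Tree}(\mathbb{N}^* )^{\mathrm{conv}}$ by $$\zeta^T(t)=\sum_{(k_v)\in D_t}\ \prod_{v\in\nu(t)}\frac1{k_v^{n_v}},\quad D_t=\{(k_v)_{v\in\nu(t)}\in(\mathbb{N}^* )^{\nu(t)}: k_v<k_w\text{ whenever }w\text{ is a strict ancestor of }v\}$$ (so $\zeta^T(|)=1$; the root carries the largest integer). **Quasi-shuffle product of trees.** For $k,l\ge1$,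 $\mathrm{Qsh}(k,l)$ is the set of surjections $\sigma:\{1,\dots,k+l\}\to\{1,\dots,n\}$ (some $n=\max(\sigma)$) with $\sigma(1)<\dots<\sigma(k)$ and $\sigma(k+1)<\dots<\sigma(k+l)$. For trees $t,s\ne|$ of $\mathrm{Tree}(\mathbb{N}^* )$, let $v_1$ (the root), $\dots,v_k$ be the internal vertices on the rightmost branch of $t$, with decorations $d_1,\dots,d_k$, and $F_i$ the ordered forest of decorated subtrees at all children of $v_i$ except the rightmost one; let $v_{k+1}$ (the root), $\dots,v_{k+l}$ be the internal vertices on the leftmost branch of $s$, with decorations $d_{k+1},\dots,d_{k+l}$, and $F_{k+i}$ the forest of subtrees at all children of $v_{k+i}$ except the leftmost one. For $\sigma\in\mathrm{Qsh}(k,l)$ with image $\{1,\dots,n\}$, $\sigma(t,s)$ is obtained from the ladder with nodes $1$ (root), $\dots,n$, ended above by a leaf, by grafting $F_i$ to the left of the ladder at node $\sigma(i)$ for $i\le k$ and to the right at node $\sigma(i)$ for $i>k$, keeping the decorations of the $F_i$, and decorating node $m$ by $d_i$ if $\sigma^{-1}(\{m\})=\{i\}$ and by $d_i+d_j$ if $\sigma^{-1}(\{m\})=\{i,j\}$. Then $t*s=\sum_{\sigma\in\mathrm{Qsh}(k,l)}\sigma(t,s)$; $|$ is the unit of $*$, and $*$ is extended bilinearly. *)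

(* Defs.v *)
From HB Require Import structures.
From mathcomp Require Import all_boot all_order all_algebra.
From mathcomp.multinomials Require Import freeg.
From mathcomp Require Import boolp classical_sets reals ereal esum.

Set Implicit Arguments.
Unset Strict Implicit.
Unset Printing Implicit Defensive.

Import Order.TTheory GRing.Theory Num.Theory.

Local Open Scope classical_set_scope.
Local Open Scope ring_scope.

(* A plane rooted tree with a natural number on each internal vertex:
   [GenTree.Node n cs] has decoration [n] and children [cs], listed from left
   to right; the unlabelled [GenTree.Leaf tt] is the tree [|]. *)
Notation ptree := (GenTree.tree unit).
Notation lf := (GenTree.Leaf tt).

(* A vertex with [m] children has [m.-1] angles. There is at least one angle, so
   the bound on the decoration also makes it positive. *)
Fixpoint schroeder (t : ptree) : bool :=
  if t is GenTree.Node n cs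
  then [&& (1 < size cs)%N, ((size cs).-1 <= n)%N & all schroeder cs]
  else true.

Record stree := STree { sval_tree :> ptree; streeP : schroeder sval_tree }.

HB.instance Definition _ := [isSub for sval_tree].
HB.instance Definition _ := [Choice of stree by <:].

Definition bar : stree := @STree lf isT.

Notation Tree R := {freeg stree / R}.

Definition conv_tree (t : stree) : bool :=
  if val t is GenTree.Node n _ then n != 1%N else true.

Definition conv (R : realType) : set (Tree R) :=
  [set x | exists2 s : seq (R * stree),
     all (fun ct => conv_tree ct.2) s & x = \sum_(ct <- s) ct.1 *: << ct.2 >>].

(* An internal vertex is encoded by its address: the sequence of positions,
   counted from the left and from 0, of the children met on the path to it from
   the root. *)
Fixpoint vertices (t : ptree) : seq (seq nat) :=
  if t is GenTree.Node _ cs then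
    [::] :: flatten [seq [seq iv.1 :: p | p <- iv.2]
                    | iv <- zip (iota 0 (size cs)) [seq vertices c | c <- cs]]
  else [::].

Notation vertex t := (seq_sub (vertices t)).

Fixpoint decoration_at (t : ptree) (p : seq nat) : nat :=
  match t, p with
  | GenTree.Node n _, [::] => n
  | GenTree.Node _ cs, i :: q => nth (fun=> 0%N) [seq decoration_at c | c <- cs] i q
  | GenTree.Leaf _, _ => 0%N
  end.

Definition decoration (t : ptree) (v : vertex t) : nat :=
  decoration_at t (val v).

Definition ancestor (t : ptree) (w v : vertex t) : bool :=
  prefix (val w) (val v) && (w != v).

Definition labellings (t : ptree) : set {ffun vertex t -> nat} :=
  [set k | (forall v, (0 < k v)%N) /\
           (forall v w, ancestor w v -> (k v < k w)%N)].

Definition zeta_term (R : realType) (t : ptree) (k : {ffun vertex t -> nat}) : R :=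
  \prod_(v : vertex t) (((k v)%:R : R) ^+ decoration v)^-1.

(* [fine] sends an infinite sum to 0, so this is the intended value only if the
   series is summable over [labellings t]. *)
Definition zeta_tree (R : realType) (t : stree) : R :=
  fine (\esum_(k in @labellings t) (zeta_term R k)%:E).

Definition zetaT (R : realType) : Tree R -> R^o :=
  fglift (zeta_tree R : stree -> R^o).

Lemma zetaT_linear (R : realType) : linear (@zetaT R).
Proof.
have zB : {morph @zetaT R : x y / x - y} by exact: lift_is_additive.
have z0 : zetaT (0 : Tree R) = 0 by rewrite -(subr0 0) zB subrr.
have zN : {morph @zetaT R : x / - x} by move=> x; rewrite -sub0r zB z0 sub0r.
have zD : {morph @zetaT R : x y / x + y}.
  by move=> x y; rewrite -[y in LHS]opprK zB zN opprK.
move=> a x y; rewrite zD; congr (_ + _).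
rewrite -[x]freeg_sumE scaler_sumr !(big_morph _ zD z0) scaler_sumr.
apply: eq_bigr => t _.
have -> : a *: << coeff t x *g t >> = << a * coeff t x *g t >>.
  by apply/eqP/freeg_eqP => u; rewrite coeffZ !coeffU mulrA.
by rewrite /zetaT !liftU scalerA.
Qed.

HB.instance Definition _ (R : realType) :=
  GRing.isLinear.Build R (Tree R) R^o *:%R (@zetaT R) (@zetaT_linear R).

(* The vertices of the rightmost branch from the root up, each one given by its
   decoration and the forest of subtrees at its children off the branch. *)
Fixpoint right_branch (t : ptree) : seq (nat * seq ptree) :=
  if t is GenTree.Node n cs then
    (n, take (size cs).-1 cs) :: last [::] [seq right_branch c | c <- cs]
  else [::].

Fixpoint left_branch (t : ptree) : seq (nat * seq ptree) :=
  if t is GenTree.Node n cs then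
    (n, behead cs) :: head [::] [seq left_branch c | c <- cs]
  else [::].

(* The ladder with one node for each triple (decoration, forest grafted on the
   left, forest grafted on the right), from the root up to a final leaf. *)
Definition ladder (s : seq (nat * seq ptree * seq ptree)) : ptree :=
  foldr (fun x t => GenTree.Node x.1.1 (x.1.2 ++ t :: x.2)) lf s.

(* {1, ..., k + l} and {1, ..., n} are 'I_(k + l) and 'I_n; the first k indices
   are the [lshift l i] and the last l are the [rshift k j]. *)
Definition is_qsh (k l n : nat) (sigma : {ffun 'I_(k + l) -> 'I_n}) : bool :=
  [&& [forall m, m \in codom sigma],
      [forall i : 'I_k, forall j : 'I_k,
         (i < j)%N ==> (sigma (lshift l i) < sigma (lshift l j))%N] &
      [forall i : 'I_l, forall j : 'I_l,
         (i < j)%N ==> (sigma (rshift k i) < sigma (rshift k j))%N]].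

Notation Qsh k l n := {sigma : {ffun 'I_(k + l) -> 'I_n} | is_qsh sigma}.

(* The fibre of a quasi-shuffle over [m] has one or two elements, in the latter
   case one among the first k and one among the last l. *)
Definition qsh_node (u v : seq (nat * seq ptree)) (n : nat)
    (sigma : 'I_(size u + size v) -> 'I_n) (m : 'I_n) :
    nat * seq ptree * seq ptree :=
  let d i := (nth (0%N, [::]) (u ++ v) i).1 in
  let F i := (nth (0%N, [::]) (u ++ v) i).2 in
  ((\sum_(i < size u + size v | sigma i == m) d i)%N,
   flatten [seq F (lshift (size v) i) | i <- enum 'I_(size u)
                                      & sigma (lshift (size v) i) == m],
   flatten [seq F (rshift (size u) j) | j <- enum 'I_(size v)
                                      & sigma (rshift (size u) j) == m]).

Definition qsh_ptree (t s : ptree) (n : nat)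
    (sigma : Qsh (size (right_branch t)) (size (left_branch s)) n) : ptree :=
  ladder [seq qsh_node (val sigma) m | m <- enum 'I_n].

Definition branch_ok (x : nat * seq ptree) : bool :=
  [&& (0 < size x.2)%N, (size x.2 <= x.1)%N & all schroeder x.2].

Lemma right_branch_ok t : schroeder t -> all branch_ok (right_branch t).
Proof.
elim: t => // n cs IH /and3P[cs2 csn csS] /=.
apply/andP; split.
  have le_cs : ((size cs).-1 <= size cs)%N by exact: leq_pred.
  have cs1 : (0 < (size cs).-1)%N by rewrite -subn1 subn_gt0.
  rewrite /branch_ok /= size_takel // csn cs1 /=; move: csS.
  by rewrite -{1}(cat_take_drop (size cs).-1 cs) all_cat => /andP[].
elim/last_ind: cs IH csS {cs2 csn} => // cs c _ + csS.
have {csS} : schroeder c by move: csS; rewrite all_rcons => /andP[].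
rewrite map_rcons last_rcons.
move=> cS; elim: cs => [|b cs IHcs] /=; first by case=> IHc _; exact: IHc.
by case=> _; exact: IHcs.
Qed.

Lemma left_branch_ok t : schroeder t -> all branch_ok (left_branch t).
Proof.
elim: t => // n [|c cs] //= [IHc _] /and4P[cs2 csn cS csS].
by apply/andP; split; [apply/and3P | exact: IHc].
Qed.

Lemma ladder_schroeder s :
    all (fun x => branch_ok (x.1.1, x.1.2 ++ x.2)) s -> schroeder (ladder s).
Proof.
elim: s => //= x s IH /andP[/and3P[/= F0 Fx FS] /IH sS].
move: F0 Fx FS; rewrite size_cat all_cat => F0 Fx /andP[FS GS].
by rewrite size_cat /= addnS ltnS F0 /= Fx all_cat /= FS sS GS.
Qed.

Lemma qsh_schroeder t s n
    (sigma : Qsh (size (right_branch t)) (size (left_branch s)) n) :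
  schroeder t -> schroeder s -> schroeder (qsh_ptree sigma).
Proof.
move=> /right_branch_ok; rewrite /qsh_ptree; move: (right_branch t) sigma => u.
move=> + + /left_branch_ok; move: (left_branch s) => v [/= sigma /and3P[surj _ _]].
move=> uS vS; apply/ladder_schroeder/allP => _ /mapP[m _ ->].
have ok i : branch_ok (nth (0%N, [::]) (u ++ v) i) || (size u + size v <= i)%N.
  case: leqP => [|lt_i]; first by rewrite orbT.
  rewrite -size_cat in lt_i; rewrite orbF.
  by apply: (all_nthP (0%N, [::]) _ i lt_i); rewrite all_cat uS.
have {}ok (i : 'I_(size u + size v)) : branch_ok (nth (0%N, [::]) (u ++ v) i).
  by have := ok i; rewrite leqNgt ltn_ord orbF.
have sizeE : size ((qsh_node sigma m).1.2 ++ (qsh_node sigma m).2)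
    = (\sum_(i < size u + size v | sigma i == m)
         size (nth (0%N, [::]) (u ++ v) i).2)%N.
  rewrite /= size_cat !size_flatten /shape -!map_comp !sumnE !big_map.
  by rewrite !big_filter !big_enum_cond /= big_split_ord.
apply/and3P; split; rewrite /= ?sizeE.
- have /forallP/(_ m)/codomP[i ->] := surj.
  by rewrite (bigD1 i) //= addn_gt0; have /and3P[-> _ _] := ok i.
- by apply: leq_sum => i _; have /and3P[] := ok i.
- rewrite all_cat; apply/andP; split; apply/allP => c /flattenP[_ /mapP[i _ ->]].
    by have /and3P[_ _ /allP] := ok (lshift (size v) i); apply.
  by have /and3P[_ _ /allP] := ok (rshift (size u) i); apply.
Qed.

Definition qsh_tree (t s : stree) (n : nat)
    (sigma : Qsh (size (right_branch t)) (size (left_branch s)) n) : stree :=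
  STree (qsh_schroeder sigma (streeP t) (streeP s)).

(* The image of a quasi-shuffle of type (k, l) has at most k + l elements. *)
Definition tree_prod (R : realType) (t s : stree) : Tree R :=
  if t == bar then << s >> else if s == bar then << t >> else
  let k := size (right_branch t) in
  let l := size (left_branch s) in
  \sum_(n < (k + l).+1) \sum_(sigma : Qsh k l n) << qsh_tree sigma >>.

Definition qsh_prod (R : realType) (x y : Tree R) : Tree R :=
  fglift (fun t => fglift (tree_prod R t) y) x.

(* Main.v *)
(* Truncate the series to labels at most K. Fixing the label of the root leaves
   independent labellings of the subtrees at its children, so the truncated value
   of a tree is a nested sum over strictly decreasing labels along its rightmost
   (or leftmost) branch, in which the off-branch forests enter only as weights.
   A product of two such nested sums is a sum over pairs of decreasing sequences;
   standardizing each pair gives a quasi-shuffle and one decreasing sequence, which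
   is the required identity for every finite K. A tree with v vertices has truncated
   value at most H_K ^ v, with H_K the harmonic sum, so a root decoration of at
   least 2 makes the series converge and the identity passes to the limit. *)

Require Import Defs.
From HB Require Import structures.
From mathcomp Require Import all_boot all_order all_algebra.
From mathcomp.multinomials Require Import freeg.
From mathcomp Require Import boolp classical_sets functions cardinality fsbigop.
From mathcomp Require Import reals ereal esum.
From mathcomp Require Import topology normedtype sequences.
From mathcomp Require Import zify ring lra.

Set Implicit Arguments.
Unset Strict Implicit.
Unset Printing Implicit Defensive.

Import Order.TTheory GRing.Theory Num.Theory.
Import numFieldNormedType.Exports.

Local Open Scope classical_set_scope.
Local Open Scope ring_scope.

(** * Nested sums and quasi-shuffles *)

(** The head of the list carries the largest index, as a root does, and the indices strictly
    decrease along the list. *)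
Fixpoint nested_sum (A : pzSemiRingType) (T : Type) (f : T -> nat -> A)
    (s : seq T) (K : nat) : A :=
  if s is x :: s' then \sum_(k < K) f x k * nested_sum f s' k else 1.

Definition decreasing n K (y : {ffun 'I_n -> 'I_K}) : bool :=
  [forall i : 'I_n, forall j : 'I_n, (i < j)%N ==> (y j < y i)%N].

Lemma decreasingP n K (y : {ffun 'I_n -> 'I_K}) :
  reflect (forall i j : 'I_n, (i < j)%N -> (y j < y i)%N) (decreasing y).
Proof.
apply: (iffP forallP) => [dy i j|dy i]; last by apply/forallP => j; apply/implyP/dy.
by have /forallP/(_ j)/implyP := dy i.
Qed.

Lemma decreasing_le n K (y : {ffun 'I_n -> 'I_K}) (i j : 'I_n) :
  decreasing y -> (y i < y j)%N -> (j < i)%N.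
Proof.
move=> /decreasingP dy; rewrite ltnNge; apply: contraNltn.
by rewrite leq_eqVlt => /predU1P[/ord_inj-> //|/dy/ltnW].
Qed.

Lemma decreasing_inj n K (y : {ffun 'I_n -> 'I_K}) : decreasing y -> injective y.
Proof.
by move=> /decreasingP dy i j e; apply/ord_inj/eqP; case: ltngtP => // /dy; rewrite e ltnn.
Qed.

(** Listed in the order of the arguments, the values form a strictly decreasing sequence, and such a
    sequence is determined by its set of entries. *)
Lemma decreasing_codom n K (y y' : {ffun 'I_n -> 'I_K}) :
  decreasing y -> decreasing y' -> codom y =i codom y' -> y = y'.
Proof.
have sorted_codom z : decreasing z -> sorted gtn [seq nat_of_ord k | k <- codom z].
  move=> /decreasingP dz; rewrite -map_comp sorted_map.
  apply: (@sub_sorted _ (relpre val ltn)) => [i j|]; first exact: dz.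
  by rewrite -sorted_map val_enum_ord iota_ltn_sorted.
move=> dy dy' yy'; have : codom y = codom y'.
  apply: (inj_map (@ord_inj K)); apply: (@irr_sorted_eq _ gtn); rewrite ?sorted_codom //.
  - by move=> a b c ba ac; exact: ltn_trans ac ba.
  - by move=> a; exact: ltnn.
  - by move=> a; apply/mapP/mapP => -[k + ->]; exists k; rewrite ?yy' // -yy'.
by rewrite !codomE => /eq_in_map eyy; apply/ffunP => i; apply: eyy; rewrite mem_enum.
Qed.

(** The bound [K] changes at each level of the nested sum. The fixed codomain ['I_M] lets the
    induction vary [K] without changing the type of [y]. *)
Lemma nested_sumE_le (A : comPzSemiRingType) (T : Type) (f : T -> nat -> A)
    n (s : n.-tuple T) M K :
    (K <= M)%N ->
  nested_sum f s K =
  \sum_(y : {ffun 'I_n -> 'I_M} | decreasing y && [forall i, (y i < K)%N])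
    \prod_(i < n) f (tnth s i) (y i).
Proof.
elim: n s K => [|n IH] s K KM.
  rewrite tuple0 /=; pose y0 : {ffun 'I_0 -> 'I_M} := ffun0 (card_ord 0).
  rewrite (bigD1 y0) /=.
    rewrite big_ord0 big1 ?addr0 // => y /andP[_ /eqP[]].
    by apply/ffunP => -[].
  by apply/andP; split; [apply/decreasingP => -[] | apply/forallP => -[]].
case/tupleP: s => x s /=.
rewrite (big_ord_widen M (fun k => f x k * nested_sum f s k)) //.
under [LHS]eq_bigr => k kK do rewrite (IH _ _ (ltnW (ltn_ord k))) big_distrr /=.
rewrite [LHS]pair_big_dep /=.
(* [h] prepends the index of the head to the indices of the tail. *)
pose h (p : 'I_M * {ffun 'I_n -> 'I_M}) : {ffun 'I_n.+1 -> 'I_M} :=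
  [ffun i => oapp p.2 p.1 (unlift ord0 i)].
have h0 p : h p ord0 = p.1 by rewrite ffunE unlift_none.
have hS p (i : 'I_n) : h p (fintype.lift ord0 i) = p.2 i by rewrite ffunE liftK.
rewrite [RHS](reindex h) /=; last first.
  exists (fun y => (y ord0, [ffun i => y (fintype.lift ord0 i)])) => [[k y] _|y _].
    by rewrite h0; congr pair; apply/ffunP => i; rewrite ffunE hS.
  by apply/ffunP => i; case: (unliftP ord0 i) => [j|] ->; rewrite ?h0 ?hS ?ffunE.
apply: eq_big => [[k y]|[k y] _] /=; last first.
  by rewrite big_ord_recl tnth0 h0; congr (_ * _); apply: eq_bigr => i _; rewrite tnthS hS.
apply/idP/idP => [/and3P[kK /decreasingP dy /forallP yk]|].
  apply/andP; split.
    apply/decreasingP => i j; case: (unliftP ord0 i) => [i'|] ->;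
      case: (unliftP ord0 j) => [j'|] -> //; rewrite ?h0 ?hS //=.
    by rewrite /bump /= !add1n ltnS => /dy.
  apply/forallP => i; case: (unliftP ord0 i) => [i'|] ->; rewrite ?h0 ?hS //=.
  exact: ltn_trans (yk _) kK.
case/andP=> /decreasingP dy /forallP yK; have := yK ord0; rewrite h0 => -> /=.
apply/andP; split.
  apply/decreasingP => i j ij; rewrite -!(hS (k, y)); apply: dy => /=.
  by rewrite /bump /= !add1n ltnS.
by apply/forallP => i; rewrite -(hS (k, y)) -{2}[k]/((k, y).1) -h0; exact: dy.
Qed.

Lemma nested_sumE (A : comPzSemiRingType) (T : Type) (f : T -> nat -> A)
    n (s : n.-tuple T) K :
  nested_sum f s K =
  \sum_(y : {ffun 'I_n -> 'I_K} | decreasing y) \prod_(i < n) f (tnth s i) (y i).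
Proof.
rewrite (nested_sumE_le _ _ (leqnn K)); apply: eq_bigl => y.
by rewrite (introT forallP) ?andbT // => i; exact: ltn_ord.
Qed.

Definition left_part k l (T : Type) (x : {ffun 'I_(k + l) -> T}) : {ffun 'I_k -> T} :=
  [ffun i => x (lshift l i)].

Definition right_part k l (T : Type) (x : {ffun 'I_(k + l) -> T}) : {ffun 'I_l -> T} :=
  [ffun j => x (rshift k j)].

Lemma nested_sumM (A : comPzSemiRingType) (T : Type) (f : T -> nat -> A)
    k l (s : k.-tuple T) (t : l.-tuple T) K :
  nested_sum f s K * nested_sum f t K =
  \sum_(x : {ffun 'I_(k + l) -> 'I_K}
        | decreasing (left_part x) && decreasing (right_part x))
    \prod_(i < k + l) f (tnth (cat_tuple s t) i) (x i).
Proof.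
rewrite !nested_sumE big_distrlr pair_big /=.
pose h (x : {ffun 'I_(k + l) -> 'I_K}) := (left_part x, right_part x).
rewrite (reindex h) /=; last first.
  exists (fun p : {ffun 'I_k -> 'I_K} * {ffun 'I_l -> 'I_K} =>
    [ffun i => match fintype.split i with inl i => p.1 i | inr j => p.2 j end]).
    move=> x _; apply/ffunP => i; rewrite ffunE.
    by case: splitP => j ij; rewrite ffunE; congr (x _); apply: ord_inj.
  move=> [y z] _; congr pair; apply/ffunP => i; rewrite !ffunE.
    by case: fintype.split (unsplitK (inl i : 'I_k + 'I_l)) => // j [->].
  by case: fintype.split (unsplitK (inr i : 'I_k + 'I_l)) => // j [->].
apply: eq_bigr => x _; rewrite big_split_ord /=; congr (_ * _); apply: eq_bigr => i _.
  by rewrite tnth_lshift ffunE.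
by rewrite tnth_rshift ffunE.
Qed.

Lemma qsh_surj k l n (sigma : {ffun 'I_(k + l) -> 'I_n}) m :
  is_qsh sigma -> exists i, sigma i = m.
Proof. by case/and3P => /forallP/(_ m)/codomP[i ->] _ _; exists i. Qed.

(* Standardization: [x] determines [y] as the decreasing enumeration of its image. *)
Lemma sum_standardize (A : nmodType) k l K (G : {ffun 'I_(k + l) -> 'I_K} -> A) :
  \sum_(x | decreasing (left_part x) && decreasing (right_part x)) G x =
  \sum_(n < (k + l).+1) \sum_(sigma : {ffun 'I_(k + l) -> 'I_n} | is_qsh sigma)
    \sum_(y : {ffun 'I_n -> 'I_K} | decreasing y) G [ffun i => y (sigma i)].
Proof.
have card_x (x : {ffun 'I_(k + l) -> 'I_K}) : (#|codom x| < (k + l).+1)%N.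
  by rewrite ltnS -[X in (_ <= X)%N]card_ord; exact: leq_image_card.
rewrite (partition_big (fun x => Ordinal (card_x x)) predT) //=.
apply: eq_bigr => n _; rewrite pair_big /=.
pose B := [pred p : {ffun 'I_(k + l) -> 'I_n} * {ffun 'I_n -> 'I_K}
           | is_qsh p.1 && decreasing p.2].
pose h (p : {ffun 'I_(k + l) -> 'I_n} * {ffun 'I_n -> 'I_K}) :
  {ffun 'I_(k + l) -> 'I_K} := [ffun i => p.2 (p.1 i)].
have codom_h p : p \in B -> codom (h p) =i codom p.2.
  case: p => sigma y; rewrite inE => /andP[/= qs _] m; apply/codomP/codomP => -[i ->].
    by exists (sigma i); rewrite ffunE.
  by have [j <-] := qsh_surj i qs; exists j; rewrite ffunE.
(* The image of [h p] is that of [p.2], so it determines [p.2]; as [p.2] is injective, [p.1] is then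
   determined too. *)
have h_inj : {in B &, injective h}.
  move=> p q pB qB e; have ey : p.2 = q.2.
    move: (pB) (qB); rewrite !inE => /andP[_ dp] /andP[_ dq].
    by apply: decreasing_codom => // m; rewrite -!codom_h // e.
  move: p q pB qB e ey => [sigma y] [tau z]; rewrite inE => /andP[_ /= dy] _ + ezy.
  rewrite -ezy => e; congr pair; apply/ffunP => i; apply: (decreasing_inj dy).
  by move/ffunP/(_ i): e; rewrite !ffunE.
transitivity (\sum_(p in B) G (h p)); last by apply: eq_bigl => p; rewrite inE.
rewrite -(big_imset _ h_inj) /=; apply: eq_bigl => x; apply/idP/imsetP; last first.
  case=> -[sigma y] pB ->; apply/andP; split; last first.
    apply/eqP/ord_inj; rewrite /= (eq_card (codom_h _ pB)) card_codom ?card_ord //.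
    by move: pB; rewrite inE => /andP[_]; exact: decreasing_inj.
  move: pB; rewrite inE => /andP[/= /and3P[_ /forallP sl /forallP sr] /decreasingP dy].
  apply/andP; split; apply/decreasingP => i j ij; rewrite !ffunE; apply: dy.
    by have /forallP/(_ j)/implyP := sl i; apply.
  by have /forallP/(_ j)/implyP := sr i; apply.
case/andP=> /andP[/decreasingP dl /decreasingP dr] /eqP/(congr1 val)/= cx.
(* The image of [x] in decreasing order: [y] reads off its entries, and [sigma i] is the rank of
   [x i] in it. *)
pose s := rev (enum (codom x)).
have us : uniq s by rewrite rev_uniq enum_uniq.
have ms : s =i codom x by move=> a; rewrite mem_rev mem_enum.
have ss : size s == n by rewrite size_rev -cardE cx.
have ds : sorted (relpre (@nat_of_ord K) gtn) s.
  rewrite rev_sorted; apply: (@sorted_filter _ (relpre (@nat_of_ord K) ltn)).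
    by move=> a b c; exact: ltn_trans.
  by rewrite -sorted_map -enumT val_enum_ord iota_ltn_sorted.
have s_lt i : (index (x i) s < n)%N by rewrite -(eqP ss) index_mem ms codom_f.
pose y := [ffun i : 'I_n => tnth (Tuple ss) i].
pose sigma := [ffun i => Ordinal (s_lt i)].
have yE i : y (sigma i) = x i.
  by rewrite /y ffunE (tnth_nth (x i)) ffunE /= nth_index // ms codom_f.
have dy : decreasing y.
  apply/decreasingP => i j ij; have k0 : 'I_K := y i; rewrite !ffunE !(tnth_nth k0) /=.
  have tr : transitive (relpre (@nat_of_ord K) gtn).
    by move=> a b c ba ac; exact: ltn_trans ac ba.
  by apply: (sorted_ltn_nth tr k0 ds) => //; rewrite inE (eqP ss).
exists (sigma, y); last by apply/ffunP => i; rewrite ffunE yE.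
rewrite inE /= dy andbT; apply/and3P; split.
- apply/forallP => m; have : tnth (Tuple ss) m \in codom x by rewrite -ms mem_tnth.
  case/codomP=> i e; apply/codomP; exists i; apply: (decreasing_inj dy).
  by rewrite yE -e ffunE.
- apply/forallP => i; apply/forallP => j; apply/implyP => ij.
  by apply: (decreasing_le dy); rewrite !yE; have := dl _ _ ij; rewrite !ffunE.
- apply/forallP => i; apply/forallP => j; apply/implyP => ij.
  by apply: (decreasing_le dy); rewrite !yE; have := dr _ _ ij; rewrite !ffunE.
Qed.

(** * Truncated zeta values as nested sums along branches *)

(* The index [k] stands for the label [k.+1] of the root, so that the labels of the
   subtrees are at most [k]. *)
Fixpoint zeta_trunc (R : realType) (t : ptree) (K : nat) : R :=
  if t is GenTree.Node n cs
  then \sum_(k < K) (k.+1%:R ^+ n)^-1 * \prod_(f <- [seq zeta_trunc R c | c <- cs]) f k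
  else 1.

(** The factor contributed by a branch vertex labelled [k.+1] together with its off-branch subtrees,
    whose labels are at most [k]. *)
Definition node_weight (R : realType) (x : nat * seq ptree) (k : nat) : R :=
  (k.+1%:R ^+ x.1)^-1 * \prod_(c <- x.2) zeta_trunc R c k.

Lemma zeta_trunc_node (R : realType) n cs K :
  zeta_trunc R (GenTree.Node n cs) K = \sum_(k < K) node_weight R (n, cs) k.
Proof. by apply: eq_bigr => k _; rewrite big_map. Qed.

(** Positions past the last child read as [lf], where [P] holds, so the induction hypothesis carries
    no range condition. *)
Lemma ptree_nth_ind (P : ptree -> Prop) :
  P lf -> (forall n cs, (forall i, P (nth lf cs i)) -> P (GenTree.Node n cs)) ->
  forall t, P t.
Proof.
move=> Plf PN; elim=> [[]//|n cs IH]; apply: PN.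
by elim: cs IH => [_|c cs IHcs /= [Pc /IHcs Pcs]] [|i] //=.
Qed.

Lemma zeta_trunc_ladder (R : realType) s K :
  zeta_trunc R (ladder s) K =
  nested_sum (fun x => node_weight R (x.1.1, x.1.2 ++ x.2)) s K.
Proof.
elim: s K => // x s IH K /=; apply: eq_bigr => k _.
by rewrite big_map /node_weight /= !big_cat big_cons /= IH; ring.
Qed.

(** The factor of the last child is taken out of the product over the children and expanded
    recursively; the other factors make up the weight of the vertex. *)
Lemma zeta_trunc_right (R : realType) t K :
  zeta_trunc R t K = nested_sum (node_weight R) (right_branch t) K.
Proof.
elim/ptree_nth_ind: t K => // n cs IH K; rewrite zeta_trunc_node.
apply: eq_bigr => k _; rewrite /node_weight /= -mulrA; congr (_ * _).
case/lastP: cs IH => [|cs c] IH; first by rewrite /= !big_nil mulr1.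
rewrite size_rcons /= -cats1 take_size_cat // big_cat big_seq1 map_cat last_cat /=.
by have := IH (size cs) k; rewrite nth_rcons ltnn eqxx => ->.
Qed.

Lemma zeta_trunc_left (R : realType) t K :
  zeta_trunc R t K = nested_sum (node_weight R) (left_branch t) K.
Proof.
elim/ptree_nth_ind: t K => // n [|c cs] IH K; rewrite zeta_trunc_node.
  by apply: eq_bigr => k _; rewrite /node_weight /= big_nil mulr1.
apply: eq_bigr => k _; rewrite /node_weight /= big_cons -mulrA; congr (_ * _).
by have /= -> := IH 0%N k; rewrite mulrC.
Qed.

(** Merging vertices adds decorations and concatenates forests, and the weight turns both operations
    into products. *)
Lemma node_weight_qsh (R : realType) u v n
    (sigma : 'I_(size u + size v) -> 'I_n) m k :
  let x := qsh_node sigma m in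
  node_weight R (x.1.1, x.1.2 ++ x.2) k =
  \prod_(i < size u + size v | sigma i == m) node_weight R (nth (0%N, [::]) (u ++ v) i) k.
Proof.
rewrite /node_weight /= big_split /= prodfV prodrXr; congr (_ * _).
rewrite big_cat !big_flatten !big_map !big_filter !big_enum_cond /=.
by rewrite big_split_ord.
Qed.

(** The morphism identity at a finite level: the product of the nested sums along the two branches
    is standardized, and each quasi-shuffle gives the nested sum of its ladder. *)
Lemma zeta_truncM (R : realType) t s K :
  zeta_trunc R t K * zeta_trunc R s K =
  let k := size (right_branch t) in
  let l := size (left_branch s) in
  \sum_(n < (k + l).+1) \sum_(sigma : Qsh k l n) zeta_trunc R (qsh_ptree sigma) K.
Proof.
rewrite zeta_trunc_right zeta_trunc_left /=.
rewrite (nested_sumM _ (in_tuple (right_branch t)) (in_tuple (left_branch s))).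
rewrite (sum_standardize (fun x => \prod_i node_weight R (tnth _ i) (x i))).
apply: eq_bigr => n _; rewrite big_sub; apply: eq_bigr => -[sigma qs] _ /=.
rewrite zeta_trunc_ladder.
transitivity (nested_sum (fun x => node_weight R (x.1.1, x.1.2 ++ x.2))
                (map_tuple (qsh_node sigma) (ord_tuple n)) K); last by [].
rewrite nested_sumE; apply: eq_bigr => y _.
(* The factors are grouped by the node of the ladder to which [sigma] sends them. *)
rewrite (partition_big sigma predT) //=; apply: eq_bigr => m _.
rewrite tnth_map tnth_ord_tuple node_weight_qsh; apply: eq_bigr => i /eqP im.
by rewrite (tnth_nth (0%N, [::])) ffunE im.
Qed.

Lemma zeta_trunc_ge0 (R : realType) t K : 0 <= zeta_trunc R t K.
Proof.
elim/ptree_nth_ind: t K => [K|n cs IH K]; first exact: ler01.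
rewrite zeta_trunc_node; apply: sumr_ge0 => k _; rewrite mulr_ge0 ?invr_ge0 ?exprn_ge0 //.
by rewrite (big_nth lf) big_mkord prodr_ge0.
Qed.

(** * Convergence *)

Definition harmonic_sum (R : realType) (K : nat) : R := \sum_(k < K) k.+1%:R^-1.

Lemma harmonic_sumS (R : realType) K :
  harmonic_sum R K.+1 = harmonic_sum R K + K.+1%:R^-1.
Proof. exact: big_ord_recr. Qed.

Lemma harmonic_sum_ge0 (R : realType) K : 0 <= harmonic_sum R K.
Proof. by apply: sumr_ge0 => k _; rewrite invr_ge0. Qed.

Lemma harmonic_sum_le (R : realType) k K :
  (k <= K)%N -> harmonic_sum R k <= harmonic_sum R K.
Proof.
move=> /subnK<-; elim: (K - k)%N => // n IH; apply: le_trans IH _.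
by rewrite addSn harmonic_sumS lerDl invr_ge0.
Qed.

(** A mean value inequality for powers, by induction on the exponent. *)
Lemma exprS_sub_le (R : realDomainType) (a b : R) n :
  0 <= a -> a <= b -> b ^+ n.+1 - a ^+ n.+1 <= n.+1%:R * b ^+ n * (b - a).
Proof.
move=> a0 ab; have b0 := le_trans a0 ab; elim: n => [|n IH].
  by rewrite !expr1 expr0 !mul1r.
have le1 : b * (b ^+ n.+1 - a ^+ n.+1) <= b * (n.+1%:R * b ^+ n * (b - a)).
  exact: ler_wpM2l.
have le2 : a ^+ n.+1 * (b - a) <= b ^+ n.+1 * (b - a).
  by rewrite ler_wpM2r ?subr_ge0 // lerXn2r ?nnegrE.
have -> : b ^+ n.+2 - a ^+ n.+2 =
    b * (b ^+ n.+1 - a ^+ n.+1) + a ^+ n.+1 * (b - a) by rewrite !exprS; ring.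
have -> : n.+2%:R * b ^+ n.+1 * (b - a) =
    b * (n.+1%:R * b ^+ n * (b - a)) + b ^+ n.+1 * (b - a).
  by rewrite -(natr1 n.+1) exprS; ring.
exact: lerD.
Qed.

(* Summation by parts against [2 / k], which decreases by at least [1 / k ^ 2]. *)
Lemma sum_harmonic_pow_le (R : realType) N K :
  \sum_(k < K) (k.+1%:R ^+ 2)^-1 * harmonic_sum R k.+1 ^+ N <= (2 ^ N.+1 * N`!)%:R.
Proof.
pose T N K : R := \sum_(k < K) (k.+1%:R ^+ 2)^-1 * harmonic_sum R k.+1 ^+ N.
have step (k : nat) : (k.+1%:R ^+ 2)^-1 + 2 / k.+2%:R <= 2 / k.+1%:R :> R.
  have k0 : 0 < k.+1%:R :> R by rewrite ltr0n.
  rewrite -(natr1 k.+1) -subr_ge0; set x : R := k.+1%:R.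
  have x1 : 1 <= x by rewrite ler1n.
  have -> : 2 / x - ((x ^+ 2)^-1 + 2 / (x + 1)) = (x - 1) / (x ^+ 2 * (x + 1)).
    by field; apply/andP; split; lra.
  by rewrite divr_ge0 ?mulr_ge0 //; lra.
rewrite -/(T N K); elim: N K => [|N IH] K.
  (* The term [2 / K.+1%:R] makes the bound inductive: [step] absorbs each new summand into its
     decrease. *)
  suff le2 : T 0%N K + 2 / K.+1%:R <= 2.
    by apply: le_trans le2; rewrite lerDl divr_ge0.
  elim: K => [|K IH]; first by rewrite /T big_ord0 add0r divr1.
  rewrite /T big_ord_recr /= -/(T 0%N K) expr0 mulr1 -addrA.
  by apply: le_trans IH; rewrite lerD2l.
(* Again a boundary term is kept so that the induction on [K'] closes. Dropping it bounds [T N.+1]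
   by [2 * N.+1%:R] times [T N]; together with the bound 2 on [T 0], this is where the constant
   comes from. *)
suff le K' : T N.+1 K' + 2 / K'.+1%:R * harmonic_sum R K' ^+ N.+1 <=
             2 * N.+1%:R * T N K'.
  have : T N.+1 K <= 2 * N.+1%:R * T N K.
    apply: le_trans (le K); rewrite lerDl mulr_ge0 ?divr_ge0 //.
    by rewrite exprn_ge0 // harmonic_sum_ge0.
  move=> /le_trans; apply.
  have -> : (2 ^ N.+2 * N.+1`!)%:R = 2 * N.+1%:R * (2 ^ N.+1 * N`!)%:R :> R.
    by rewrite -!natrM factS expnS; congr _%:R; lia.
  by rewrite ler_wpM2l // mulr_ge0.
elim: K' => [|k IHk].
  by rewrite /T !big_ord0 /harmonic_sum big_ord0 expr0n /= !mulr0 addr0.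
rewrite /T !big_ord_recr /= -/(T N k) -/(T N.+1 k).
set a := harmonic_sum R k; set b := harmonic_sum R k.+1; set x : R := k.+1%:R.
have bE : b - a = x^-1 by rewrite /b harmonic_sumS addrAC subrr add0r.
have diff : 2 / x * (b ^+ N.+1 - a ^+ N.+1) <= 2 / x * (N.+1%:R * b ^+ N * x^-1).
  apply: ler_wpM2l; first by rewrite divr_ge0.
  by rewrite -bE; apply: exprS_sub_le; rewrite ?harmonic_sum_ge0 ?harmonic_sum_le.
have {}step : ((x ^+ 2)^-1 + 2 / k.+2%:R) * b ^+ N.+1 <= 2 / x * b ^+ N.+1.
  by rewrite ler_wpM2r ?step ?exprn_ge0 ?harmonic_sum_ge0.
rewrite !mulrDr; apply: le_trans (lerD IHk (lexx _)).
have -> : 2 * N.+1%:R * ((x ^+ 2)^-1 * b ^+ N) = 2 / x * (N.+1%:R * b ^+ N * x^-1).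
  by rewrite -exprVn expr2; ring.
rewrite -/a -/x -addrA -mulrDl -addrA lerD2l.
by apply: le_trans step _; rewrite -lerBlDl -mulrBr.
Qed.

Lemma prod_zeta_trunc_ge0 (R : realType) cs K : 0 <= \prod_(c <- cs) zeta_trunc R c K.
Proof. by elim/big_ind: _ => // [|c _]; [exact: mulr_ge0 | exact: zeta_trunc_ge0]. Qed.

Lemma prod_zeta_trunc_le (R : realType) cs :
    {in cs, forall c, exists N, forall K, zeta_trunc R c K <= harmonic_sum R K ^+ N} ->
  exists N, forall K, \prod_(c <- cs) zeta_trunc R c K <= harmonic_sum R K ^+ N.
Proof.
elim: cs => [_|c cs IH H]; first by exists 0%N => K; rewrite big_nil expr0.
have [N leN] := H c (mem_head _ _).
have [M leM] : exists N, forall K, \prod_(c <- cs) zeta_trunc R c K <= harmonic_sum R K ^+ N.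
  by apply: IH => d dcs; apply: H; rewrite inE dcs orbT.
exists (N + M)%N => K.
by rewrite big_cons exprD ler_pM ?zeta_trunc_ge0 ?prod_zeta_trunc_ge0.
Qed.

(** Each vertex costs one factor [harmonic_sum R K], because its decoration is positive; the
    exponents of its subtrees add up. *)
Lemma zeta_trunc_le_harmonic (R : realType) t :
  schroeder t -> exists N, forall K, zeta_trunc R t K <= harmonic_sum R K ^+ N.
Proof.
elim/ptree_nth_ind: t => [_|n cs IH /and3P[cs2 csn /allP csS]].
  by exists 0%N => K; rewrite expr0.
have [N leN] : exists N, forall K,
    \prod_(c <- cs) zeta_trunc R c K <= harmonic_sum R K ^+ N.
  apply: prod_zeta_trunc_le => c /[dup] /csS cS /(nthP lf)[i _ e].
  by rewrite -e in cS *; exact: IH.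
exists N.+1 => K; have n0 : (0 < n)%N by lia.
rewrite zeta_trunc_node exprS mulr_suml; apply: ler_sum => k _.
rewrite ler_pM ?invr_ge0 ?exprn_ge0 ?prod_zeta_trunc_ge0 //.
  rewrite lef_pV2 ?posrE ?exprn_gt0 ?ltr0n // -[X in X <= _]expr1.
  by rewrite ler_weXn2l // ler1n.
apply: le_trans (leN k) _; rewrite lerXn2r ?nnegrE ?harmonic_sum_ge0 //.
by rewrite harmonic_sum_le // ltnW.
Qed.

Lemma zeta_trunc_bounded (R : realType) (t : stree) :
  conv_tree t -> exists C : R, forall K, zeta_trunc R t K <= C.
Proof.
case: t => -[[]|n cs] /= tS; first by exists 1.
have /and3P[cs2 csn /allP csS] := tS; rewrite /conv_tree /= => n1.
(* Having at least two children forces [n] to be positive, and convergence excludes 1. *)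
have n2 : (1 < n)%N by lia.
have [N leN] : exists N, forall K,
    \prod_(c <- cs) zeta_trunc R c K <= harmonic_sum R K ^+ N.
  by apply: prod_zeta_trunc_le => c /csS; exact: zeta_trunc_le_harmonic.
exists (2 ^ N.+1 * N`!)%:R => K; rewrite -/(zeta_trunc R (GenTree.Node n cs) K).
rewrite zeta_trunc_node; apply: le_trans (sum_harmonic_pow_le R N K).
apply: ler_sum => k _; rewrite ler_pM ?invr_ge0 ?exprn_ge0 ?prod_zeta_trunc_ge0 //.
  by rewrite lef_pV2 ?posrE ?exprn_gt0 ?ltr0n // ler_weXn2l // ler1n.
apply: le_trans (leN k) _; rewrite lerXn2r ?nnegrE ?harmonic_sum_ge0 //.
exact: harmonic_sum_le.
Qed.

(** * The series as a limit of truncated sums *)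

Lemma esumZl (R : realType) (T : choiceType) (D : set T) (c : R) (f : T -> \bar R) :
  0 <= c -> (forall x, 0 <= f x)%E ->
  (\esum_(x in D) (c%:E * f x) = c%:E * \esum_(x in D) f x)%E.
Proof.
move=> c0 f0; rewrite /esum -ereal_supZl //; last first.
  by apply/set0P; exists (\sum_(x \in set0) f x)%E, set0 => //; exact: fsets_set0.
congr ereal_sup.
apply/seteqP; split => [_ [F DF <-]|_ [_ [F DF <-] <-]].
  by exists (\sum_(x \in F) f x)%E; [exists F | rewrite ge0_mule_fsumr].
by exists F => //; rewrite ge0_mule_fsumr.
Qed.

(** Independent coordinates: a sum of products over families is a product of sums. Families are
    functions on [nat], frozen at [x0] from [m] on, so that their type does not depend on [m] and
    the induction can shift indices. *)
Lemma esum_prod (R : realType) (T : choiceType) (x0 : T) m (D : nat -> set T)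
    (f : nat -> T -> R) (S : nat -> R) :
    (forall i x, 0 <= f i x) ->
    (forall i, \esum_(x in D i) (f i x)%:E = (S i)%:E) ->
  \esum_(h in [set h | (forall i, (i < m)%N -> D i (h i)) /\
                       (forall i, (m <= i)%N -> h i = x0)])
    (\prod_(i < m) f i (h i))%:E = (\prod_(i < m) S i)%:E.
Proof.
elim: m D f S => [|m IH] D f S f0 fS.
  rewrite (_ : [set h | _] = [set fun=> x0]); last first.
    apply/seteqP; split => [h [_ hx0]|_ -> //].
    by apply/funext => i; exact: hx0.
  by rewrite esum_set1 ?lee_fin ?prodr_ge0 // !big_ord0.
pose cons (p : T * (nat -> T)) i := if i is j.+1 then p.2 j else p.1.
pose H := [set h | (forall i, (i < m)%N -> D i.+1 (h i)) /\
                   (forall i, (m <= i)%N -> h i = x0)].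
rewrite (@reindex_esum R _ _ (D 0%N `*`` fun=> H) _ cons); last first.
  split.
  - move=> [x h] [/= Dx [hD hx0]]; split=> -[|i] //; [exact: hD | exact: hx0].
  - move=> [x h] [x' h'] _ _ e; congr pair; first exact: (congr1 (@^~ 0%N) e).
    by apply/funext => i; exact: (congr1 (@^~ i.+1) e).
  - move=> h [hD hx0]; exists (h 0%N, fun i => h i.+1); last by apply/funext => -[].
    by split; [exact: hD | split=> i; [exact: (hD i.+1) | exact: (hx0 i.+1)]].
pose g x (h : nat -> T) := ((f 0%N x)%:E * (\prod_(i < m) f i.+1 (h i))%:E)%E.
transitivity (\esum_(p in D 0%N `*`` fun=> H) g p.1 p.2).
  by apply: eq_esum => p _; rewrite big_ord_recl EFinM.
have P0 h : (0 <= (\prod_(i < m) f i.+1 (h i))%:E)%E by rewrite lee_fin prodr_ge0.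
rewrite -(@esum_esum _ _ _ _ (fun=> H) g) => [|x h _ _]; last by rewrite mule_ge0 // lee_fin.
(* [S 0] is unfolded back into a sum over [D 0], so that both sides are sums over the first
   coordinate. *)
rewrite big_ord_recl EFinM -fS muleC -esumZl ?prodr_ge0 //.
- apply: eq_esum => x _; rewrite esumZl //.
  by rewrite (IH (fun i => D i.+1) (fun i => f i.+1) (fun i => S i.+1)) // muleC.
- by move=> i _; rewrite -lee_fin -fS esum_ge0 // => x _; rewrite lee_fin.
- by move=> x; rewrite lee_fin.
Qed.

(** * Addresses of vertices and bounded labellings *)

Lemma vertices_node n cs :
  vertices (GenTree.Node n cs) =
  [::] :: [seq i :: p | i <- iota 0 (size cs), p <- vertices (nth lf cs i)].
Proof.
rewrite /=; congr cons.
have -> : [seq vertices c | c <- cs] =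
    [seq vertices (nth lf cs i) | i <- iota 0 (size cs)].
  by rewrite -{1}(mkseq_nth lf cs) -map_comp.
by rewrite -{1}(map_id (iota 0 _)) zip_map -map_comp.
Qed.

Lemma mem_vertices_node n cs i p :
  (i :: p \in vertices (GenTree.Node n cs)) = (p \in vertices (nth lf cs i)).
Proof.
rewrite vertices_node inE /=; apply/allpairsPdep/idP => [[j [q [_ qv [-> ->]]]] //|pv].
exists i, p; split=> //; rewrite mem_iota /= add0n ltnNge.
by apply: contraL pv => ?; rewrite nth_default.
Qed.

Lemma uniq_vertices t : uniq (vertices t).
Proof.
elim/ptree_nth_ind: t => // n cs IH; rewrite vertices_node /=; apply/andP; split.
  by apply/allpairsPdep => -[i [p []]].
apply: allpairs_uniq_dep => [|i _|[i p] [j q] _ _ /= [-> ->]] //.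
exact: iota_uniq.
Qed.

Lemma decoration_at_cons n cs i p :
  decoration_at (GenTree.Node n cs) (i :: p) = decoration_at (nth lf cs i) p.
Proof.
rewrite /=; case: (ltnP i (size cs)) => le_i; first by rewrite (nth_map lf).
by rewrite !nth_default ?size_map //; case: p.
Qed.

Lemma big_vertex (A : comPzSemiRingType) t (F : seq nat -> A) :
  \prod_(v : vertex t) F (val v) = \prod_(p <- vertices t) F p.
Proof.
rewrite -(big_map val predT F); apply: perm_big; apply: uniq_perm.
- by rewrite map_inj_uniq ?index_enum_uniq //; exact: val_inj.
- exact: uniq_vertices.
- move=> p; apply/mapP/idP => [[v _ ->]|pv]; first exact: valP.
  by exists (SeqSub pv); rewrite // mem_index_enum.
Qed.

(* Labellings by integers at most [K], as functions on all addresses that vanish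
   off the tree; unlike [{ffun vertex t -> nat}] this type does not depend on [t]. *)
Definition address_labellings (t : ptree) (K : nat) : set (seq nat -> nat) :=
  [set g | [/\ forall p, p \notin vertices t -> g p = 0%N,
               forall p, p \in vertices t -> (0 < g p <= K)%N &
               forall p q, p \in vertices t -> q \in vertices t ->
                 prefix q p -> q != p -> (g p < g q)%N]].

Definition address_term (R : realType) (t : ptree) (g : seq nat -> nat) : R :=
  \prod_(p <- vertices t) (((g p)%:R : R) ^+ decoration_at t p)^-1.

Lemma address_labellings_lf K : address_labellings lf K = [set fun=> 0%N].
Proof.
apply/seteqP; split => [g [g0 _ _]|_ -> //]; apply/funext => p; exact: g0.
Qed.

(** Vertices in different children are never comparable, so once the root label is fixed the
    children are labelled independently. The bound [(g [::]).-1] expresses that all their labels lie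
    below that of the root. *)
Lemma address_labellings_node n cs K g :
  address_labellings (GenTree.Node n cs) K g <->
  (0 < g [::] <= K)%N /\
  forall i, address_labellings (nth lf cs i) (g [::]).-1 (fun p => g (i :: p)).
Proof.
have root : [::] \in vertices (GenTree.Node n cs) by rewrite vertices_node mem_head.
split=> [[g0 gK gm]|[gK H]].
  split=> [|i]; first exact: gK.
  split=> [p pv|p pv|p q pv qv qp neq].
  - by apply: g0; rewrite mem_vertices_node.
  - have pv' : i :: p \in vertices (GenTree.Node n cs) by rewrite mem_vertices_node.
    by have := gK _ pv'; have := gm _ _ pv' root isT isT => /=; lia.
  - by apply: gm; rewrite ?mem_vertices_node ?prefix_cons ?eqxx // eqseq_cons eqxx.
split=> [[|i p]|[|i p]|[|i p] [|j q]] //.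
- by rewrite mem_vertices_node; have [+ _ _] := H i; exact.
- by rewrite mem_vertices_node => pv; have [_ /(_ p pv) + _] := H i => /=; lia.
- by rewrite mem_vertices_node => pv _ _ _; have [_ /(_ p pv) + _] := H i => /=; lia.
- rewrite !mem_vertices_node prefix_cons => pv qv /andP[/eqP ji qp]; subst j.
  by rewrite eqseq_cons eqxx => nqp; have [_ _] := H i; apply.
Qed.

Lemma address_term_node (R : realType) n cs g :
  address_term R (GenTree.Node n cs) g =
  ((g [::])%:R ^+ n)^-1 *
  \prod_(i < size cs) address_term R (nth lf cs i) (fun p => g (val i :: p)).
Proof.
rewrite /address_term vertices_node big_cons big_allpairs_dep /=; congr (_ * _).
rewrite -[X in iota _ X]subn0 -/(index_iota _ _) big_mkord; apply: eq_bigr => i _.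
by apply: eq_bigr => p _; rewrite -(decoration_at_cons n).
Qed.

Lemma address_term_ge0 (R : realType) t g : 0 <= address_term R t g.
Proof. by apply: prodr_ge0 => p _; rewrite invr_ge0 exprn_ge0. Qed.

(** Summing over the root label first leaves a sum over families of labellings of the children,
    which factors by [esum_prod]. *)
Lemma esum_address_labellings (R : realType) t K :
  \esum_(g in address_labellings t K) (address_term R t g)%:E = (zeta_trunc R t K)%:E.
Proof.
elim/ptree_nth_ind: t K => [|n cs IH] K.
  rewrite address_labellings_lf esum_set1 ?lee_fin ?address_term_ge0 //.
  by rewrite /address_term big_nil.
(* The first component [k] encodes the root label [k.+1], in agreement with the indexing of
   [zeta_trunc]. *)
pose cons (x : nat * (nat -> seq nat -> nat)) (p : seq nat) :=
  if p is i :: q then x.2 i q else x.1.+1.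
pose H k := [set h : nat -> seq nat -> nat |
  (forall i, (i < size cs)%N -> address_labellings (nth lf cs i) k (h i)) /\
  (forall i, (size cs <= i)%N -> h i = fun=> 0%N)].
rewrite (@reindex_esum R _ _ (`I_K `*`` H) _ cons); last first.
  split.
  - move=> [k h] [/= kK [hl h0]]; apply/address_labellings_node; split=> // i /=.
    case: (ltnP i (size cs)) => le_i; first exact: hl.
    by rewrite nth_default // address_labellings_lf; exact: h0.
  - move=> [k h] [k' h'] _ _ e; congr pair.
      by have [] := congr1 (@^~ [::]) e.
    by apply/funext => i; apply/funext => p; exact: (congr1 (@^~ (i :: p)) e).
  - move=> g /address_labellings_node[gK gl].
    have gE : ((g [::]).-1).+1 = g [::] by rewrite prednK //; case/andP: gK.
    exists ((g [::]).-1, fun i p => g (i :: p)); last by apply/funext => -[|i p] //=.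
    split=> /=; first by rewrite gE; case/andP: gK.
    split=> i // le_i; have := gl i; rewrite nth_default // address_labellings_lf.
    exact.
pose G k (h : nat -> seq nat -> nat) :=
  ((k.+1%:R ^+ n)^-1%:E * (\prod_(i < size cs) address_term R (nth lf cs i) (h i))%:E)%E.
transitivity (\esum_(x in `I_K `*`` H) G x.1 x.2).
  by apply: eq_esum => x _; rewrite address_term_node EFinM.
have P0 h : (0 <= (\prod_(i < size cs) address_term R (nth lf cs i) (h i))%:E)%E.
  by rewrite lee_fin prodr_ge0 // => i _; exact: address_term_ge0.
have W0 k : 0 <= (k.+1%:R ^+ n)^-1 :> R by rewrite invr_ge0 exprn_ge0.
rewrite -esum_esum => [|k h _ _]; last by rewrite mule_ge0 // lee_fin.
rewrite esum_fset //; last first.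
  by move=> k _; apply: esum_ge0 => h _; rewrite mule_ge0 // lee_fin.
rewrite -fsbig_ord zeta_trunc_node -sumEFin; apply: eq_bigr => k _.
rewrite esumZl // (@esum_prod _ _ (fun=> 0%N) _ (fun i => address_labellings (nth lf cs i) k)
  (fun i => address_term R (nth lf cs i)) (fun i => zeta_trunc R (nth lf cs i) k)) //.
- by rewrite -EFinM /node_weight /= (big_nth lf) big_mkord.
- by move=> i g; exact: address_term_ge0.
Qed.

Definition address_extension t (k : {ffun vertex t -> nat}) (p : seq nat) : nat :=
  if insub p is Some v then k v else 0%N.

Lemma address_extensionE t (k : {ffun vertex t -> nat}) v :
  address_extension k (val v) = k v.
Proof. by rewrite /address_extension valK. Qed.

Lemma zeta_termE (R : realType) t (k : {ffun vertex t -> nat}) :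
  zeta_term R k = address_term R t (address_extension k).
Proof.
rewrite /address_term -big_vertex; apply: eq_bigr => v _.
by rewrite address_extensionE.
Qed.

Definition bounded_labellings t (K : nat) : set {ffun vertex t -> nat} :=
  [set k | labellings k /\ forall v, (k v <= K)%N].

Lemma address_extension_bij t K :
  set_bij (@bounded_labellings t K) (address_labellings t K) (@address_extension t).
Proof.
split=> [k [[k0 km] kK]|k k' _ _ e|g [g0 gK gm]].
- split=> [p|p pv|p q pv qv qp neq].
  + by rewrite /address_extension; case: insubP => // v ->.
  + by rewrite -[p]/(val (SeqSub pv)) address_extensionE k0 kK.
  + rewrite -[p]/(val (SeqSub pv)) -[q]/(val (SeqSub qv)) !address_extensionE.
    by apply: km; rewrite /ancestor /= qp.
- by apply/ffunP => v; rewrite -!address_extensionE e.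
exists [ffun v => g (val v)].
  split=> [|v]; last by rewrite ffunE; have /andP[] := gK _ (valP v).
  split=> [v|v w /andP[wv nwv]]; rewrite !ffunE.
    by have /andP[] := gK _ (valP v).
  by apply: gm => //; exact: valP.
apply/funext => p; rewrite /address_extension; case: insubP => [v _ <-|/g0 //].
by rewrite ffunE.
Qed.

Lemma esum_bounded_labellings (R : realType) t K :
  \esum_(k in @bounded_labellings t K) (zeta_term R k)%:E = (zeta_trunc R t K)%:E.
Proof.
rewrite -esum_address_labellings (@reindex_esum _ _ _ _ _ _ _ (@address_extension_bij t K)).
by apply: eq_esum => k _; rewrite zeta_termE.
Qed.

(** Any finite set of labellings has bounded labels, so its sum is below some truncated value;
    conversely, each truncated value is a sum over a subset of the labellings. *)
Lemma esum_labellings (R : realType) t :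
  \esum_(k in @labellings t) (zeta_term R k)%:E =
  ereal_sup [set x%:E | x in range (zeta_trunc R t)].
Proof.
apply/eqP; rewrite eq_le; apply/andP; split; apply: ge_ereal_sup.
  move=> _ [F [finF Ft] <-]; have /finite_seqP[r Fr] := finF.
  (* The largest label occurring in the finite set. *)
  pose K := (\max_(k <- r) \max_v k v)%N.
  apply: (@le_trans _ _ (zeta_trunc R t K)%:E); last first.
    by apply: ereal_sup_ubound; exists (zeta_trunc R t K) => //; exists K.
  rewrite -esum_bounded_labellings; apply: esum_ge; exists F => //.
  split=> // k Fk; split=> [|v]; first exact: Ft.
  apply: leq_trans (leq_bigmax v) _.
  apply: (@leq_bigmax_seq _ _ _ (fun k : {ffun vertex t -> nat} => \max_v k v)%N) => //.
  by rewrite Fr in Fk.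
move=> _ [_ [K _ <-] <-]; rewrite -esum_bounded_labellings.
apply: ge_ereal_sup => _ [F [finF Ft] <-]; apply: ereal_sup_ubound.
by exists F => //; split=> // k /Ft[].
Qed.

Lemma zeta_trunc_homo (R : realType) t :
  {homo zeta_trunc R t : k K / (k <= K)%N >-> k <= K}.
Proof.
elim/ptree_nth_ind: t => // n cs _ k K kK; rewrite !zeta_trunc_node.
rewrite (big_ord_widen K (node_weight R (n, cs))) //.
rewrite [leRHS](bigID (fun i : 'I_K => i < k)%N) /=.
rewrite lerDl; apply: sumr_ge0 => i _.
by rewrite mulr_ge0 ?invr_ge0 ?exprn_ge0 ?prod_zeta_trunc_ge0.
Qed.

Lemma zeta_trunc_has_ubound (R : realType) (t : stree) :
  conv_tree t -> has_ubound (range (zeta_trunc R t)).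
Proof. by case/(zeta_trunc_bounded R) => C leC; exists C => _ [K _ <-]. Qed.

Lemma esum_labellings_conv (R : realType) (t : stree) : conv_tree t ->
  \esum_(k in @labellings t) (zeta_term R k)%:E = (sup (range (zeta_trunc R t)))%:E.
Proof.
move=> tc; rewrite esum_labellings ereal_sup_EFin //; first exact: zeta_trunc_has_ubound.
by exists (zeta_trunc R t 0), 0%N.
Qed.

Lemma zeta_trunc_cvg (R : realType) (t : stree) : conv_tree t ->
  zeta_trunc R t K @[K --> \oo] --> zeta_tree R t.
Proof.
move=> tc; rewrite /zeta_tree esum_labellings_conv //.
exact: nondecreasing_cvgn (@zeta_trunc_homo R t) (zeta_trunc_has_ubound R tc).
Qed.

(** This ensures that [fine] in [zeta_tree] returns the actual sum of the series. *)
Lemma summable_zeta_term (R : realType) (t : stree) : conv_tree t ->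
  summable (@labellings t) (fun k => (zeta_term R k)%:E).
Proof.
move=> tc; rewrite /summable (eq_esum (b := fun k => (zeta_term R k)%:E)).
  by rewrite esum_labellings_conv // ltry.
by move=> k _; rewrite gee0_abs // lee_fin zeta_termE address_term_ge0.
Qed.

Lemma zeta_tree_bar (R : realType) : zeta_tree R bar = 1.
Proof.
by rewrite -(norm_cvg_lim (@zeta_trunc_cvg R bar isT)) norm_lim_cst.
Qed.

(** * Quasi-shuffles of convergent trees *)

(** Some vertex is sent to the root of the ladder, and by monotonicity it must be the first of its
    branch. Its decoration is positive and not 1, hence at least 2, and merging only increases
    it. *)
Lemma qsh_node_decoration u v n (sigma : {ffun 'I_(size u + size v) -> 'I_n.+1}) :
    is_qsh sigma -> all branch_ok u -> all branch_ok v ->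
    (nth (0%N, [::]) u 0).1 != 1%N -> (nth (0%N, [::]) v 0).1 != 1%N ->
  (qsh_node sigma ord0).1.1 != 1%N.
Proof.
move=> qs /all_nthP uS /all_nthP vS u1 v1; have [i si] := qsh_surj ord0 qs.
rewrite /= (bigD1 i) ?si //=.
suff : (1 < (nth (0%N, [::]) (u ++ v) i).1)%N by lia.
case/and3P: qs => _ /forallP sl /forallP sr; rewrite nth_cat.
case: (splitP i) si => j ij; rewrite ij ?ltn_ord ?ltnNge ?leq_addr ?addKn /= => si.
  (* If [j] were not first, the first index of its block would be sent strictly below node 0. *)
  have j0 : nat_of_ord j = 0%N.
    have k0 : (0 < size u)%N by apply: leq_ltn_trans (ltn_ord j).
    apply/eqP; rewrite -leqn0 leqNgt; apply/negP => j0.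
    have /forallP/(_ j)/implyP/(_ j0) := sl (Ordinal k0).
    by rewrite (_ : lshift _ j = i) ?si //; exact: ord_inj.
  have := uS (0%N, [::]) 0%N; rewrite j0 -{1}j0 ltn_ord => /(_ isT)/and3P[].
  by move: u1; lia.
have j0 : nat_of_ord j = 0%N.
  have l0 : (0 < size v)%N by apply: leq_ltn_trans (ltn_ord j).
  apply/eqP; rewrite -leqn0 leqNgt; apply/negP => j0.
  have /forallP/(_ j)/implyP/(_ j0) := sr (Ordinal l0).
  by rewrite (_ : rshift _ j = i) ?si //; exact: ord_inj.
have := vS (0%N, [::]) 0%N; rewrite j0 -{1}j0 ltn_ord => /(_ isT)/and3P[].
by move: v1; lia.
Qed.

Lemma conv_qsh_tree (t s : stree) n
    (sigma : Qsh (size (right_branch t)) (size (left_branch s)) n) :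
  conv_tree t -> conv_tree s -> conv_tree (qsh_tree sigma).
Proof.
move=> tc sc; rewrite /conv_tree /= /qsh_ptree; case: n sigma => [|n] [sigma qs] /=.
  by rewrite (size0nil (size_enum_ord 0)).
rewrite enum_ordSl /=; apply: qsh_node_decoration => //.
- exact: right_branch_ok (streeP t).
- exact: left_branch_ok (streeP s).
(* When the tree is a leaf the branch is empty, and the default decoration 0 satisfies the
   condition. *)
- by case: t tc {sigma qs} => -[].
- by case: s sc {sigma qs} => -[].
Qed.

(** * Bilinear extension *)

(** The target is an arbitrary module because [qsh_prod] lifts maps with values in [Tree R]. *)
Lemma fglift_linear (R : nzRingType) (M : lmodType R) (T : choiceType) (f : T -> M) :
  linear (fglift f).
Proof.
have fB := lift_is_additive f.
have f0 : fglift f 0 = 0 by rewrite -(subrr 0) fB subrr.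
have fD : {morph fglift f : x y / x + y}.
  by move=> x y; rewrite -[y in LHS]opprK -[- y]sub0r !fB f0 sub0r opprK.
move=> a x y; rewrite fD; congr (_ + _).
rewrite -[x]freeg_sumE scaler_sumr !(big_morph _ fD f0) scaler_sumr.
apply: eq_bigr => t _.
have -> : a *: << coeff t x *g t >> = << a * coeff t x *g t >>.
  by apply/eqP/freeg_eqP => u; rewrite coeffZ !coeffU mulrA.
by rewrite /= !liftU scalerA.
Qed.

Lemma fglift_sum (R : nzRingType) (M : lmodType R) (T : choiceType) (f : T -> M)
    (s : seq (R * T)) :
  fglift f (\sum_(x <- s) x.1 *: << x.2 >>) = \sum_(x <- s) x.1 *: f x.2.
Proof.
(* The linear structure is packed locally to give access to the generic lemmas on linear maps. *)
pose F : {linear {freeg T / R} -> M} := HB.pack (fglift f)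
  (GRing.isLinear.Build _ _ _ _ (fglift f) (fglift_linear f)).
rewrite -[fglift f]/(F : _ -> _) linear_sum; apply: eq_bigr => x _.
by rewrite linearZ /= liftU scale1r.
Qed.

Lemma conv0 (R : realType) : conv (0 : Tree R).
Proof. by exists [::]; rewrite ?big_nil. Qed.

Lemma convD (R : realType) (x y : Tree R) : conv x -> conv y -> conv (x + y).
Proof.
by move=> [u uc ->] [v vc ->]; exists (u ++ v); rewrite ?all_cat ?uc ?big_cat.
Qed.

Lemma convZ (R : realType) (a : R) (x : Tree R) : conv x -> conv (a *: x).
Proof.
move=> [u uc ->]; exists [seq (a * ct.1, ct.2) | ct <- u].
  by rewrite all_map; apply: sub_all uc.
by rewrite scaler_sumr big_map; apply: eq_bigr => ct _; rewrite scalerA.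
Qed.

Lemma conv_sum (R : realType) (I : eqType) (r : seq I) (F : I -> Tree R) :
  {in r, forall i, conv (F i)} -> conv (\sum_(i <- r) F i).
Proof.
by move=> Fc; rewrite big_seq; elim/big_ind: _ => //; [exact: conv0 | exact: convD].
Qed.

Lemma conv_basis (R : realType) (t : stree) : conv_tree t -> conv (<< t >> : Tree R).
Proof. by move=> tc; exists [:: (1, t)]; rewrite /= ?tc // big_seq1 scale1r. Qed.

Lemma conv_tree_prod (R : realType) (t s : stree) :
  conv_tree t -> conv_tree s -> conv (tree_prod R t s).
Proof.
move=> tc sc; rewrite /tree_prod; case: eqP => _; first exact: conv_basis.
case: eqP => _; first exact: conv_basis.
apply: conv_sum => n _; apply: conv_sum => sigma _.
exact/conv_basis/conv_qsh_tree.
Qed.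

Lemma zetaT_basis (R : realType) t : zetaT (<< t >> : Tree R) = zeta_tree R t.
Proof. by rewrite /zetaT liftU scale1r. Qed.

Lemma zetaT_tree_prod (R : realType) (t s : stree) :
  conv_tree t -> conv_tree s -> zetaT (tree_prod R t s) = zeta_tree R t * zeta_tree R s.
Proof.
move=> tc sc; rewrite /tree_prod; case: eqP => [->|_].
  by rewrite zetaT_basis zeta_tree_bar mul1r.
case: eqP => [->|_]; first by rewrite zetaT_basis zeta_tree_bar mulr1.
rewrite linear_sum /=; under eq_bigr => n _ do rewrite linear_sum /=.
rewrite -(norm_cvg_lim (cvgM (@zeta_trunc_cvg R t tc) (@zeta_trunc_cvg R s sc))).
(* The product of the truncated values is rewritten by [zeta_truncM] as a finite sum of truncated
   values, and the limit is taken termwise. *)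
apply/esym/norm_cvg_lim; rewrite (_ : _ \* _ = fun K =>
  \sum_(n < (size (right_branch t) + size (left_branch s)).+1)
    \sum_(sigma : Qsh (size (right_branch t)) (size (left_branch s)) n)
      zeta_trunc R (qsh_tree sigma) K); last by apply/funext => K; exact: zeta_truncM.
apply: cvg_big => [|n _]; first exact: add_continuous.
apply: cvg_big => [|sigma _]; first exact: add_continuous.
by rewrite zetaT_basis; apply: zeta_trunc_cvg; exact: conv_qsh_tree.
Qed.

(** Elements of [conv] are given as such combinations, so this reduces claims about [qsh_prod] on
    [conv] to pairs of convergent trees. *)
Lemma qsh_prod_sum (R : realType) (u v : seq (R * stree)) :
  qsh_prod (\sum_(x <- u) x.1 *: << x.2 >>) (\sum_(y <- v) y.1 *: << y.2 >>) =
  \sum_(x <- u) x.1 *: \sum_(y <- v) y.1 *: tree_prod R x.2 y.2.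
Proof.
rewrite /qsh_prod fglift_sum; apply: eq_bigr => x _.
by rewrite fglift_sum.
Qed.

(** As [zetaT] is a total function, summability and the closure of [conv] under the product are
    stated alongside: they show that the identity concerns convergent series only. *)
Theorem corollary4p13 (R : realType) :
  [/\ forall t : stree, conv_tree t ->
        summable (@labellings t) (fun k => (zeta_term R k)%:E),
      zetaT (<< bar >> : Tree R) = 1,
      forall x y : Tree R, conv x -> conv y -> conv (qsh_prod x y)
    & forall x y : Tree R, conv x -> conv y ->
        zetaT (qsh_prod x y) = zetaT x * zetaT y].
Proof.
split.
- exact: summable_zeta_term.
- by rewrite zetaT_basis zeta_tree_bar.
- move=> _ _ [u /allP uc ->] [v /allP vc ->]; rewrite qsh_prod_sum.
  apply: conv_sum => x /uc xc; apply: convZ; apply: conv_sum => y /vc yc.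
  exact/convZ/conv_tree_prod.
- move=> _ _ [u /allP uc ->] [v /allP vc ->]; rewrite qsh_prod_sum !linear_sum /=.
  rewrite mulr_suml [LHS]big_seq [RHS]big_seq; apply: eq_bigr => x /uc xc.
  (* Scaling in [R^o] is multiplication in [R]; the conversion makes this visible to [mulr_sumr]. *)
  rewrite linearZ linear_sum -[LHS]/(x.1 * \sum_(y <- v) zetaT (y.1 *: tree_prod R x.2 y.2)).
  rewrite !mulr_sumr.
  rewrite [LHS]big_seq [RHS]big_seq; apply: eq_bigr => y /vc yc.
  rewrite !linearZ /= zetaT_tree_prod // !zetaT_basis /GRing.scale /=; ring.
Qed.
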